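(* Let $p\ge 3$ be a prime. For all integers $n\ge 0$, $$ \mathcal{E}_{pn}^{(p)}\equiv(-1)^n\pmod{2p^2}. $$
   Context: For an integer $d\ge 2$, the generalized Euler numbers $\mathcal{E}_n^{(d)}$, $n\ge 0$, are defined by the formal power series identity $$ \sum_{n\ge 0}\mathcal{E}_n^{(d)}\frac{x^n}{n!}=\frac{1}{1+x^d/d!+x^{2d}/(2d)!+\cdots}=\frac{1}{\sum_{k\ge 0}x^{dk}/(dk)!}, $$ i.e. $\mathcal{E}_n^{(d)}$ is $n!$ times the coefficient of $x^n$ in the multiplicative inverse of the formal power series $\sum_{k\ge0}x^{dk}/(dk)!$ over $\mathbb{Q}$. These numbers are integers. *)

(* Defs.v *)
From HB Require Import structures.
From mathcomp Require Import all_boot all_order all_algebra.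
From mathcomp Require Import ring.

Set Implicit Arguments.
Unset Strict Implicit.
Unset Printing Implicit Defensive.

Import Order.TTheory GRing.Theory Num.Theory.
Local Open Scope ring_scope.

(* A formal power series over F is its coefficient sequence [nat -> F]. *)
Section PowerSeries.
Variable F : fieldType.
Implicit Types f g : nat -> F.

Definition ps_one : nat -> F := fun n => (n == 0%N)%:R.

Definition ps_mul f g : nat -> F := fun n => \sum_(i < n.+1) f (n - i)%N * g i.

(* [ps_inv_coefs f n] lists the first [n] coefficients of 1 / f. They are
   forced by f * (1 / f) = 1 when [f 0 != 0]; see [ps_mulV]. *)
Fixpoint ps_inv_coefs f (n : nat) : seq F :=
  if n is m.+1 then
    let s := ps_inv_coefs f m in
    rcons s ((f 0%N)^-1 * (ps_one m - \sum_(i < m) f (m - i)%N * s`_i))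
  else [::].

Definition ps_inv f : nat -> F := fun n => (ps_inv_coefs f n.+1)`_n.

Lemma size_ps_inv_coefs f n : size (ps_inv_coefs f n) = n.
Proof. by elim: n => //= n IHn; rewrite size_rcons IHn. Qed.

Lemma nth_ps_inv_coefs f n i : (i < n)%N -> (ps_inv_coefs f n)`_i = ps_inv f i.
Proof.
elim: n => // n IHn; rewrite ltnS leq_eqVlt => /orP[/eqP -> //|lt_in] /=.
by rewrite nth_rcons size_ps_inv_coefs lt_in IHn.
Qed.

Lemma ps_invE f n :
  ps_inv f n
  = (f 0%N)^-1 * (ps_one n - \sum_(i < n) f (n - i)%N * ps_inv f i).
Proof.
rewrite {1}/ps_inv /= nth_rcons size_ps_inv_coefs ltnn eqxx.
congr (_ * (_ - _)); apply: eq_bigr => i _.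
by rewrite nth_ps_inv_coefs.
Qed.

Lemma ps_mulV f : f 0%N != 0 -> ps_mul f (ps_inv f) =1 ps_one.
Proof.
move=> f0 n; rewrite /ps_mul big_ord_recr /= subnn [ps_inv f n]ps_invE.
by rewrite mulrA mulfV // mul1r addrC subrK.
Qed.

Lemma ps_inv_uniq f g :
  f 0%N != 0 -> ps_mul f g =1 ps_one -> g =1 ps_inv f.
Proof.
move=> f0 fg1 n; elim/ltn_ind: n => n IHn.
rewrite ps_invE -(fg1 n) /ps_mul big_ord_recr /= subnn.
under [X in _ - X]eq_bigr => i _ do rewrite -IHn //.
by rewrite addrAC subrr add0r mulrA mulVf // mul1r.
Qed.

End PowerSeries.

(* The series \sum_(k >= 0) x^(d k) / (d k)!, for d > 0. *)
Definition multi_exp (d : nat) : nat -> rat :=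
  fun j => if (d %| j)%N then (j`!%:R)^-1 else 0.

Definition gen_euler_rat (d n : nat) : rat :=
  n`!%:R * ps_inv (multi_exp d) n.

(* [numq] only retypes an integral rational as an [int]; see
   [gen_euler_ratE]. *)
Definition gen_euler (d n : nat) : int := numq (gen_euler_rat d n).

Lemma gen_euler_rat_rec d n :
  gen_euler_rat d n
  = (n == 0%N)%:R
    - \sum_(i < n) if (d %| n - i)%N then 'C(n, i)%:R * gen_euler_rat d i
                   else 0.
Proof.
have fact_neq0 m : m`!%:R != 0 :> rat by rewrite pnatr_eq0 -lt0n fact_gt0.
rewrite {1}/gen_euler_rat ps_invE /multi_exp dvdn0 fact0 invr1 mul1r mulrBr.
congr (_ - _).
  by rewrite /ps_one; case: n => [|n]; rewrite ?mulr1 ?mulr0.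
rewrite big_distrr; apply: eq_bigr => i _ /=.
case: ifP => _; last by rewrite mul0r mulr0.
rewrite /gen_euler_rat -(bin_fact (ltnW (ltn_ord i))) !natrM.
by field; rewrite !fact_neq0.
Qed.

Lemma gen_euler_ratE d n : gen_euler_rat d n = (gen_euler d n)%:~R.
Proof.
suff /intrP[m Em] : gen_euler_rat d n \is a Num.int.
  by rewrite /gen_euler Em numq_int.
elim/ltn_ind: n => n IHn; rewrite gen_euler_rat_rec rpredB ?natr_int //.
apply: rpred_sum => i _; case: ifP => // _.
by rewrite rpredM ?natr_int ?IHn.
Qed.

(* Main.v *)
Require Import Defs.
From mathcomp Require Import all_boot all_order all_algebra.

(** The defining identity of the generalized Euler numbers, read at the
    exponents divisible by [p], says that the sequence [gen_euler p (p * j)] is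
    inverted by the triangular unipotent array ['C(p * n, p * j)]:
      [\sum_(j <= n) 'C(p * n, p * j) * gen_euler p (p * j) = (n == 0)].
    A sequence satisfying such a system modulo [m] is determined modulo [m], so
    it suffices to show that [(-1) ^+ j] also satisfies it modulo [2 * p ^ 2],
    i.e. that for [n > 0] the alternating sum
      [\sum_(j <= n) 'C(p * n, p * j) * (-1) ^+ j]
    is divisible by [p ^ 2] and by [2], which are coprime as [p] is odd.

    - Modulo [p ^ 2], ['C(p * n, p * j)] is congruent to ['C(n, j)]
      ([bin_mulp_modp2]), and the sum becomes [(1 - 1) ^+ n = 0].
    - Modulo [2], Pascal's rule splits ['C(p * n, p * j)] into two binomials
      with upper index [p * n - 1] that are exchanged by [j -> n - j]; the sum
      is therefore a multiple of [1 + (-1) ^+ n], which is even. *)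

Set Implicit Arguments.
Unset Strict Implicit.
Unset Printing Implicit Defensive.

Import Order.TTheory GRing.Theory Num.Theory.
Local Open Scope ring_scope.

Lemma big_ord_multiples (V : nmodType) (d n : nat) (F : nat -> V) :
  (0 < d)%N ->
  \sum_(i < d * n) (if (d %| i)%N then F i else 0) = \sum_(j < n) F (d * j)%N.
Proof.
move=> d_gt0; elim: n => [|n IHn]; first by rewrite muln0 !big_ord0.
rewrite big_ord_recr -IHn mulnSr big_split_ord /=; congr (_ + _).
rewrite (bigD1 (Ordinal d_gt0)) //= addn0 dvdn_mulr // big1 ?addr0 // => i.
rewrite -val_eqE /= => i_neq0; rewrite dvdn_addr ?dvdn_mulr // gtnNdvd //.
by rewrite lt0n.
Qed.

Lemma gen_euler_mul_sum (d n : nat) : (0 < d)%N ->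
  \sum_(j < n.+1) 'C(d * n, d * j)%:Z * gen_euler d (d * j) = (n == 0%N)%:Z.
Proof.
move=> d_gt0; rewrite big_ord_recr /= binn mul1r.
apply: (@intr_inj rat); rewrite rmorphD /= -gen_euler_ratE gen_euler_rat_rec.
rewrite muln_eq0 eqn0Ngt d_gt0 /= addrC -addrA -[RHS]addr0; congr (_ + _).
apply/eqP; rewrite addrC subr_eq0 rmorph_sum /=; apply/eqP.
under eq_bigr => j _ do rewrite rmorphM /= -gen_euler_ratE.
rewrite -(big_ord_multiples _ (fun i => 'C(d * n, i)%:R * gen_euler_rat d i)) //.
by apply: eq_bigr => i _; rewrite dvdn_subr ?dvdn_mulr // ltnW.
Qed.

(** Subtracting the two systems leaves [gen_euler d (d * n) - u n] plus
    combinations of the earlier differences, because the diagonal entries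
    ['C(d * n, d * n)] are 1. *)
Lemma gen_euler_mul_unique_mod (d : nat) (m : int) (u : nat -> int) :
  (0 < d)%N ->
  (forall n, (m %| \sum_(j < n.+1) 'C(d * n, d * j)%:Z * u j
                   - (n == 0%N)%:Z)%Z) ->
  forall n, (gen_euler d (d * n) = u n %[mod m])%Z.
Proof.
move=> d_gt0 u_sum n; apply/eqP; rewrite eqz_mod_dvd.
elim/ltn_ind: n => n IHn.
have := u_sum n; rewrite -(gen_euler_mul_sum n d_gt0) -sumrB big_ord_recr /=.
rewrite binn !mul1r rpredDl => [|]; first by rewrite -opprB rpredN.
by apply: rpred_sum => j _; rewrite -mulrBr dvdz_mull // -opprB rpredN IHn.
Qed.

(** [k * 'C(p * a, k)] is a multiple of [p * a], and [k], being prime to [p],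
    can be cancelled. *)
Lemma prime_dvd_bin_mul (p a k : nat) :
  prime p -> ~~ (p %| k)%N -> (p %| 'C(p * a, k))%N.
Proof.
case: k => [|k] p_pr; first by rewrite dvdn0.
move=> p_ndvd_k; rewrite -(Gauss_dvdr _ (n := k.+1)) ?prime_coprime //.
have [->|pa_gt0] := posnP (p * a)%N; first by rewrite bin0n muln0 dvdn0.
by rewrite -mul_bin_diag -mulnA dvdn_mulr.
Qed.

(** Vandermonde's convolution expands the left-hand side over the terms
    ['C(p, j) * 'C(p * a, k - j)]. Away from [j = 0] and [j = p] either both
    factors are divisible by [p], or [j > p] and the first one vanishes. *)
Lemma bin_mulp_step (p a k : nat) : prime p -> (p %| k)%N -> (p <= k)%N ->
  'C(p * a.+1, k) = ('C(p * a, k) + 'C(p * a, k - p))%N %[mod p ^ 2].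
Proof.
move=> p_pr p_dvd_k; rewrite -ltnS => p_lt_Sk.
rewrite mulnS -binomial.Vandermonde (bigD1 ord0) //= bin0 mul1n subn0.
rewrite (bigD1 (Ordinal p_lt_Sk)) /=.
  rewrite binn mul1n addnA -[in LHS]modnDmr.
  suff /eqP -> : (p ^ 2 %| \sum_(j < k.+1 | (j != ord0)
                            && (j != Ordinal p_lt_Sk))
                            'C(p, j) * 'C(p * a, k - j))%N by rewrite addn0.
  apply/dvdn_sum => j; rewrite -!val_eqE /= => /andP[j_neq0 j_neqp].
  have [p_lt_j|] := ltnP p j; first by rewrite bin_small // mul0n dvdn0.
  rewrite leq_eqVlt (negPf j_neqp) /= => j_lt_p.
  have p_ndvd_j : ~~ (p %| j)%N by rewrite gtnNdvd // lt0n.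
  rewrite expnS expn1 dvdn_mul //.
    by rewrite prime_dvd_bin // lt0n j_neq0.
  by rewrite prime_dvd_bin_mul // dvdn_subr // -ltnS.
by rewrite -val_eqE /= -lt0n prime_gt0.
Qed.

(** Both sides satisfy Pascal's recurrence in [(a, b)], the left one modulo
    [p ^ 2] by [bin_mulp_step], with the same boundary values. *)
Lemma bin_mulp_modp2 (p a b : nat) : prime p ->
  'C(p * a, p * b) = 'C(a, b) %[mod p ^ 2].
Proof.
move=> p_pr; elim: a b => [|a IHa] [|b]; rewrite ?muln0 ?bin0 //.
  by rewrite bin0n muln_eq0 eqn0Ngt prime_gt0.
rewrite bin_mulp_step ?dvdn_mulr ?leq_pmulr // {2}mulnS addKn.
by rewrite binS -modnDm !IHa modnDm.
Qed.

(** Reflecting the term ['C(n.-1, k.-1)] of Pascal's rule makes the two terms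
    swap under [k -> n - k] and covers [k = 0]. *)
Lemma bin_pascal_sym (n k : nat) : (0 < n)%N -> (k <= n)%N ->
  'C(n, k) = ('C(n.-1, k) + 'C(n.-1, n - k))%N.
Proof.
case: n k => // n [|k] _; first by rewrite subn0 !bin0 bin_small.
by rewrite ltnS subSS => k_le_n; rewrite binS bin_sub.
Qed.

Lemma alt_sum_bin_mulp_modp2 (p n : nat) : prime p -> (0 < n)%N ->
  ((p ^ 2)%N%:Z %| \sum_(j < n.+1) 'C(p * n, p * j)%:Z * (-1) ^+ j)%Z.
Proof.
move=> p_pr n_gt0.
have alt0 : \sum_(j < n.+1) 'C(n, j)%:Z * (-1) ^+ j = 0%R :> int.
  transitivity ((1 - 1 : int) ^+ n); last by rewrite subrr expr0n gtn_eqF.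
  rewrite exprDn; apply: eq_bigr => j _.
  by rewrite expr1n mul1r -mulr_natl natz.
rewrite -[X in (_ %| X)%Z]subr0 -[X in (_ %| _ - X)%Z]alt0 -sumrB.
apply: rpred_sum => j _.
rewrite -mulrBl dvdz_mulr // -eqz_mod_dvd !modz_nat eqz_nat.
exact/eqP/bin_mulp_modp2.
Qed.

(** The reflection in [bin_pascal_sym] changes the sign [(-1) ^+ j] into
    [(-1) ^+ (n - j)], so the sum is [1 + (-1) ^+ n] times the sum [T] of the
    unreflected halves. *)
Lemma alt_sum_bin_mul_even (d n : nat) : (0 < d)%N -> (0 < n)%N ->
  (2 %| \sum_(j < n.+1) 'C(d * n, d * j)%:Z * (-1) ^+ j)%Z.
Proof.
move=> d_gt0 n_gt0.
pose T := \sum_(j < n.+1) 'C((d * n).-1, d * j)%:Z * (-1) ^+ j : int.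
suff -> : \sum_(j < n.+1) 'C(d * n, d * j)%:Z * (-1) ^+ j
          = (1 + (-1) ^+ n) * T.
  by rewrite dvdz_mulr // -signr_odd; case: (odd n).
have T_rev : (-1) ^+ n * T
             = \sum_(j < n.+1) 'C((d * n).-1, d * (n - j))%:Z * (-1) ^+ j.
  rewrite /T (reindex_inj rev_ord_inj) mulr_sumr; apply: eq_bigr => j _ /=.
  rewrite subSS mulrCA -exprD; congr (_ * _).
  have j_le_n : (j <= n)%N by rewrite -ltnS.
  by rewrite -{1}(subnKC j_le_n) -addnA addnn -muln2 exprD exprM sqrr_sign mulr1.
rewrite mulrDl mul1r T_rev /T -big_split; apply: eq_bigr => j _ /=.
rewrite -mulrDl -PoszD mulnBr -bin_pascal_sym ?muln_gt0 ?d_gt0 //.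
by rewrite leq_pmul2l // -ltnS.
Qed.

Theorem theorem4p4 (p : nat) (hp : prime p) (hp3 : (3 <= p)%N) (n : nat) :
  (gen_euler p (p * n)%N = (-1) ^+ n %[mod (2 * p ^ 2)%N%:Z])%Z.
Proof.
have p_gt0 := prime_gt0 hp.
apply: (gen_euler_mul_unique_mod (u := fun j => (-1) ^+ j)) => // -[|k].
  by rewrite big_ord_recl big_ord0 muln0 bin0.
have co_2_p2 : coprimez 2 (p ^ 2)%N%:Z.
  rewrite coprimezE coprimeXr // prime_coprime // dvdn_prime2 //.
  by rewrite ltn_eqF.
rewrite subr0 PoszM Gauss_dvdz // alt_sum_bin_mul_even //=.
exact: alt_sum_bin_mulp_modp2.
Qed.
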